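(* Let $n\ge 2$ be an integer, let $a_0,a_1,\dots,a_{n-1}\in\mathbb{C}$ with $a_0=\rho e^{i\theta}\neq 0$ ($\rho>0$, $-\pi<\theta\le\pi$), and consider, for a real parameter $t>0$, the polynomial equation $$x^n=\left(a_{n-1}x^{n-1}+a_{n-2}x^{n-2}+\dots+a_1x+a_0\right)t^n .\qquad (\ast)$$ Let $W(q)$, $q=1,2,\dots$, be the vectors in $\mathbb{C}^{n-1}$, let $S_q(\alpha,|a_0|)$, $q=2,\dots,n$, be the numbers, and let $\|M\|$ and $C_r$ be as defined in the context. Put $$\beta_m=\rho^{m/n}\,e^{im\theta/n}\,\frac{W(m)_1}{a_0},\qquad m=1,2,\dots,$$ where $W(m)_1$ is the first component of $W(m)$, and let $RC(a)\in[0,\infty]$ be the radius of convergence of the power series $\sum_{m\ge1}\beta_m t^m$. Then: (1) $\sum_{m\ge 1}|\beta_m t^m|$ converges for $|t|<RC(a)$, and in particular it converges whenever $$|t|<LBRC(\alpha,|a_0|):=\frac14\left(\max_{k=1,2,\dots,n-1}\left(\frac{S_{k+1}(\alpha,|a_0|)\,\|M\|}{C_{k-1}\,|a_0|^{1-k/n}}\right)^{1/k}\right)^{-1}.$$ (2) If $|t|<RC(a)$, the $n$ convergent series $$x(t,k)=\sum_{m=1}^{\infty}\beta_m e^{2k\pi m i/n}\,t^m,\qquad k=0,1,\dots,n-1,$$ are the $n$ roots of $(\ast)$ in the following sense: writing $x(t,k)_q=\sum_{m=1}^{q}\beta_m e^{2k\pi m i/n}t^m$ for the partial sums, for each $k=0,1,\dots,n-1$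 the expression $$E(x(t,k)_q):=[x(t,k)_q]^n-\left(a_{n-1}[x(t,k)_q]^{n-1}+a_{n-2}[x(t,k)_q]^{n-2}+\dots+a_1x(t,k)_q+a_0\right)t^n$$ tends to $0$ as $q\to\infty$.
   Context: $\alpha:=\max_{k=1,\dots,n-1}|a_k|$. $M$ is the $(n-1)\times(n-1)$ real matrix with entries $M_{i,j}=\frac{i}{n}$ if $i\le j$ and $M_{i,j}=-\frac{n-i}{n}$ if $i>j$. $\|M\|=\max_i\sum_{j}|M_{i,j}|$ is the row-sum norm. $C_r=\frac{(2r)!}{(r+1)!\,r!}$, $r=0,1,2,\dots$, are the Catalan numbers. The numbers $S_q(\alpha,|a_0|)$, $q=2,\dots,n$, are defined recursively by $$S_2(\alpha,|a_0|)=\alpha+\frac{\alpha}{\|M\|},$$ $$S_q(\alpha,|a_0|)=\frac1{|a_0|}\left(\sum_{p=1}^{q-2}\left[\|M\|\,S_{p+1}(\alpha,|a_0|)+\alpha\right]S_{q-p}(\alpha,|a_0|)\right)+\alpha+\frac{\alpha}{\|M\|},\quad q=3,\dots,n.$$ The column vectors $W(q)\in\mathbb{C}^{n-1}$ are defined recursively by $$W(1)=a_0(1,1,\dots,1)^{T},\qquad W(2)=\frac{a_1}{n}(1,2,\dots,n-1)^{T},$$ $$W(q)=\frac1{a_0}\left[-M\sum_{p=1}^{q-2}[u\cdot W(p+1)]\,W(q-p)+U\sum_{p=1}^{\min(n-1,q-1)}[A_p\cdot W(q-p)]\right],\quad q=3,4,\dots,$$ where $u$ is the $(n-1)$-dimensional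 row vector with $1$ in first position and zeros elsewhere, $U=\frac1n(1,2,\dots,n-1)^{T}$, and $A_p$ ($p=1,\dots,n-1$) is the $(n-1)$-dimensional row vector with $a_p$ in $p$-th position and zeros elsewhere (so $u\cdot W(p+1)=W(p+1)_1$ and $A_p\cdot W(q-p)=a_pW(q-p)_p$). $\rho^{m/n}$ denotes the positive real power. If the maximum defining $LBRC(\alpha,|a_0|)$ is $0$ (i.e. $\alpha=0$), then $LBRC(\alpha,|a_0|)=+\infty$. *)

(* Defs.v *)
From HB Require Import structures.
From mathcomp Require Import all_boot all_order all_algebra.
From mathcomp Require Import all_classical all_reals all_analysis.
From mathcomp Require Export complex.
Set Implicit Arguments.
Unset Strict Implicit.
Unset Printing Implicit Defensive.
Import Order.TTheory GRing.Theory Num.Theory.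
Import numFieldNormedType.Exports.
Local Open Scope classical_set_scope.
Local Open Scope complex_scope.
Local Open Scope ring_scope.

(* R[i] only carries its topology through its regular algebra R[i]^o, hence
   the ascriptions to R[i]^o in the convergence statements below. *)

Definition modC (R : realType) (z : R[i]) : R := ComplexField.Normc.normc z.

Definition expi (R : realType) (x : R) : R[i] := cos x +i* sin x.

(* Course-of-values recursion: covrec x0 step q applies step q to a function
   agreeing with covrec x0 step below q (see covrecE). *)
Fixpoint covtable (T : Type) (x0 : T) (step : nat -> (nat -> T) -> T) (q : nat)
    : nat -> T :=
  match q with
  | 0 => fun _ => x0
  | q'.+1 => let w := covtable x0 step q' in
             fun i => if i == q' then step q' w else w i
  end.

Definition covrec (T : Type) (x0 : T) (step : nat -> (nat -> T) -> T) (q : nat)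
    : T :=
  covtable x0 step q.+1 q.

Lemma covrecE (T : Type) (x0 : T) (step : nat -> (nat -> T) -> T) (q : nat) :
  covrec x0 step q =
  step q (fun i => if (i < q)%N then covrec x0 step i else x0).
Proof.
have tabE m : covtable x0 step m =
    (fun i => if (i < m)%N then covrec x0 step i else x0).
  elim: m => [|m IH] /=; apply/funext => i //.
  have [->|neq] := eqVneq i m; first by rewrite ltnSn /covrec /= eqxx.
  by rewrite IH ltnS [in RHS]leq_eqVlt (negbTE neq).
by rewrite {1}/covrec /= eqxx tabE.
Qed.

(* Indices 1, ..., n-1 are encoded as 'I_n.-1 with a shift by one: the ordinal
   i stands for the index i.+1. *)
Definition Mmx (R : realType) (n : nat) : 'M[R]_n.-1 :=
  \matrix_(i, j) if (i <= j)%N then i.+1%:R / n%:R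
                 else - ((n - i.+1)%:R / n%:R).

Definition rowsum_norm (R : realType) (m n : nat) (A : 'M[R]_(m, n)) : R :=
  \big[Num.max/0]_(i < m) \sum_(j < n) `|A i j|.

Definition normM (R : realType) (n : nat) : R := rowsum_norm (Mmx R n).

Definition catalan (R : realType) (r : nat) : R :=
  ((2 * r)%N)`!%:R / (r.+1`! * r`!)%N%:R.

(* The coefficients a_0, ..., a_(n-1) are the first n values of a : nat -> R[i];
   the other values are never used. *)
Definition alpha (R : realType) (n : nat) (a : nat -> R[i]) : R :=
  \big[Num.max/0]_(1 <= k < n) modC (a k).

(* Only the values at q = 2, 3, ... are meaningful. *)
Definition S_step (R : realType) (n : nat) (al r0 : R) (q : nat)
    (s : nat -> R) : R :=
  if (q <= 1)%N then 0
  else if q == 2%N then al + al / normM R n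
  else r0^-1 * (\sum_(1 <= p < q.-1) (normM R n * s p.+1 + al) * s (q - p)%N)
       + al + al / normM R n.

Definition Sseq (R : realType) (n : nat) (al r0 : R) : nat -> R :=
  covrec 0 (S_step n al r0).

Lemma S2E (R : realType) (n : nat) (al r0 : R) :
  Sseq n al r0 2%N = al + al / normM R n.
Proof. by rewrite /Sseq covrecE. Qed.

Lemma SE (R : realType) (n : nat) (al r0 : R) (q : nat) : (3 <= q)%N ->
  Sseq n al r0 q =
  r0^-1 * (\sum_(1 <= p < q.-1)
             (normM R n * Sseq n al r0 p.+1 + al) * Sseq n al r0 (q - p)%N)
  + al + al / normM R n.
Proof.
case: q => [|[|[|q]]] // _; rewrite [LHS]covrecE /S_step /=.
congr (_ * _ + _ + _); apply: eq_big_nat => p /andP[p1 pq].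
by rewrite ltnS pq ltn_subrL p1.
Qed.

Definition uvec (R : realType) (n : nat) : 'rV[R[i]]_n.-1 :=
  \row_j (j.+1 == 1%N)%:R.

Definition Uvec (R : realType) (n : nat) : 'cV[R[i]]_n.-1 :=
  \col_i (i.+1%:R / n%:R).

Definition Avec (R : realType) (n : nat) (a : nat -> R[i]) (p : nat)
    : 'rV[R[i]]_n.-1 :=
  \row_j (if j.+1 == p then a p else 0).

Definition dotC (R : realType) (n : nat) (v : 'rV[R[i]]_n) (w : 'cV[R[i]]_n)
    : R[i] := (v *m w) 0 0.

(* Only the values at q = 1, 2, ... are meaningful. *)
Definition W_step (R : realType) (n : nat) (a : nat -> R[i]) (q : nat)
    (w : nat -> 'cV[R[i]]_n.-1) : 'cV[R[i]]_n.-1 :=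
  if q == 0%N then 0
  else if q == 1%N then a 0%N *: const_mx 1
  else if q == 2%N then (a 1%N / n%:R) *: \col_i i.+1%:R
  else (a 0%N)^-1 *:
    (- map_mx (real_complex R) (Mmx R n) *m
         (\sum_(1 <= p < q.-1) dotC (uvec R n) (w p.+1) *: w (q - p)%N)
     + (\sum_(1 <= p < (minn n.-1 q.-1).+1) dotC (Avec n a p) (w (q - p)%N))
         *: Uvec R n).

Definition Wseq (R : realType) (n : nat) (a : nat -> R[i])
    : nat -> 'cV[R[i]]_n.-1 :=
  covrec 0 (@W_step R n a).

Lemma W1E (R : realType) (n : nat) (a : nat -> R[i]) :
  Wseq n a 1%N = a 0%N *: const_mx 1.
Proof. by rewrite /Wseq covrecE. Qed.

Lemma W2E (R : realType) (n : nat) (a : nat -> R[i]) :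
  Wseq n a 2%N = (a 1%N / n%:R) *: \col_i i.+1%:R.
Proof. by rewrite /Wseq covrecE. Qed.

Lemma WE (R : realType) (n : nat) (a : nat -> R[i]) (q : nat) : (3 <= q)%N ->
  Wseq n a q = (a 0%N)^-1 *:
    (- map_mx (real_complex R) (Mmx R n) *m
         (\sum_(1 <= p < q.-1) dotC (uvec R n) (Wseq n a p.+1) *: Wseq n a (q - p)%N)
     + (\sum_(1 <= p < (minn n.-1 q.-1).+1)
          dotC (Avec n a p) (Wseq n a (q - p)%N)) *: Uvec R n).
Proof.
case: q => [|[|[|q]]] // _; rewrite [LHS]covrecE /W_step /=.
congr (_ *: (_ *m _ + _ *: _)); apply: eq_big_nat => p /andP[p1 pq].
  by rewrite ltnS pq ltn_subrL p1.
by rewrite ltn_subrL p1.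
Qed.

(* dotC (uvec R n) w is the first component of w. *)
Definition beta (R : realType) (n : nat) (a : nat -> R[i]) (rho theta : R)
    (m : nat) : R[i] :=
  (rho `^ (m%:R / n%:R))%:C * expi (m%:R * theta / n%:R)
  * (dotC (uvec R n) (Wseq n a m) / a 0%N).

(* Radius of convergence of the complex power series \sum_(m >= 1) c_m z^m:
   supremum of the moduli of its points of convergence. *)
Definition conv_radius (R : realType) (c : nat -> R[i]) : \bar R :=
  ereal_sup [set (modC z)%:E | z in
    [set z : R[i] |
      cvgn ((fun q => \sum_(1 <= m < q.+1) c m * z ^+ m) : nat -> R[i]^o)]].

Definition RC (R : realType) (n : nat) (a : nat -> R[i]) (rho theta : R)
    : \bar R :=
  conv_radius (beta n a rho theta).

(* The inverse is taken in \bar R, where 0^-1 = +oo. *)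
Definition LBRC (R : realType) (n : nat) (al r0 : R) : \bar R :=
  ((4^-1)%:E *
   ((\big[Num.max/0]_(1 <= k < n)
       (Sseq n al r0 k.+1 * normM R n
        / (catalan R k.-1 * r0 `^ (1 - k%:R / n%:R))) `^ (k%:R^-1))%:E)^-1)%E.

Definition xpart (R : realType) (n : nat) (a : nat -> R[i]) (rho theta t : R)
    (k q : nat) : R[i] :=
  \sum_(1 <= m < q.+1)
    beta n a rho theta m * expi (2 * k%:R * pi * m%:R / n%:R) * t%:C ^+ m.

Definition Eres (R : realType) (n : nat) (a : nat -> R[i]) (t : R) (x : R[i])
    : R[i] :=
  x ^+ n - (\sum_(j < n) a j * x ^+ j) * t%:C ^+ n.

(* Main.v *)
(* Write x = tau w with tau^n = a_0 t^n; then x solves the equation iff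
   w^n = 1 + sum_p (a_p / a_0) tau^p w^p.  The i-th entries of W(1), W(2), ...,
   divided by a_0, are the coefficients of a power series g_i in tau, and the
   recursion for W is a linear system for h_i = g_i - 1 with matrix M.  Subtracting
   consecutive rows gives g_(i+1) = g_i g_1, hence g_i = g_1^i, and the last row
   says that w = g_1 solves the equation formally.
   Truncating g_1 at degree q therefore leaves a polynomial defect divisible by
   tau^q; its coefficients are controlled by the norm sum |p_i| r^i with |tau| < r,
   which is submultiplicative, so the defect is O((|tau| / r)^q).
   For the lower bound on the radius, the Catalan convolution identity propagates
   |W(k+1)_i| <= |a_0| C_(k-1) b^k / ||M|| from k < n, where it is the definition
   of LBRC, to all k, and C_r <= 4^r. *)
Require Import Defs.
From HB Require Import structures.
From mathcomp Require Import all_boot all_order all_algebra.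
From mathcomp Require Import all_classical all_reals all_analysis.
From mathcomp Require Import complex.
From mathcomp Require Import ring lra zify.
Set Implicit Arguments.
Unset Strict Implicit.
Unset Printing Implicit Defensive.
Import Order.TTheory GRing.Theory Num.Theory.
Import numFieldNormedType.Exports.
Local Open Scope classical_set_scope.
Local Open Scope complex_scope.
Local Open Scope ring_scope.

(** * Catalan numbers: recurrence, growth and convolution *)

Lemma catalan0 (R : realType) : catalan R 0 = 1.
Proof. by rewrite /catalan !fact0 muln1 divr1. Qed.

Lemma catalanS (R : realType) (r : nat) :
  r.+2%:R * catalan R r.+1 = (4 * r + 2)%N%:R * catalan R r.
Proof.
rewrite /catalan mulnSr addn2 !factS !natrM -!natr1 !natrM ?natrD.
have h0 m : m`!%:R != 0 :> R by rewrite pnatr_eq0 -lt0n fact_gt0.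
by field; rewrite h0 !natr1 !pnatr_eq0.
Qed.

Lemma catalan_gt0 (R : realType) (r : nat) : 0 < catalan R r.
Proof. by rewrite divr_gt0 // ltr0n ?muln_gt0 ?fact_gt0. Qed.

Lemma catalan_le (R : realType) (r : nat) : catalan R r <= 4 ^+ r.
Proof.
elim: r => [|r IH]; first by rewrite catalan0.
rewrite -(ler_pM2l (ltr0Sn R r.+1)) catalanS.
have r2 : (4 * r + 2)%N%:R <= r.+2%:R * 4 :> R.
  by rewrite -natrM ler_nat; lia.
rewrite exprS [leRHS]mulrA; apply: ler_pM => //; exact: ltW (catalan_gt0 R r).
Qed.

(* Symmetrising p <-> k - p turns the weight p + 1 into k / 2 + 1; combined with
   the two-term recurrence catalanS this determines the convolutions
   successively. *)
Lemma catalan_convolution (R : realType) (k : nat) :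
  \sum_(p < k.+1) catalan R p * catalan R (k - p) = catalan R k.+1.
Proof.
pose D k : R := \sum_(p < k.+1) catalan R p * catalan R (k - p).
pose T k : R := \sum_(p < k.+1) p.+1%:R * (catalan R p * catalan R (k - p)).
have TD m : 2 * T m = m.+2%:R * D m.
  have -> : 2 * T m = T m + \sum_(p < m.+1)
      (m - p).+1%:R * (catalan R p * catalan R (m - p)).
    rewrite mulr_natl mulr2n {2}/T; congr (_ + _).
    rewrite (reindex_inj rev_ord_inj) /=; apply: eq_bigr => p _.
    by rewrite !subSS subKn ?leq_ord// [X in _ * X]mulrC.
  rewrite -big_split mulr_sumr; apply: eq_bigr => p _ /=.
  rewrite -mulrDl -natrD; congr (_%:R * _).
  by have := ltn_ord p; lia.
have TS m : T m.+1 = catalan R m.+1 + 4 * T m - 2 * D m.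
  rewrite /T big_ord_recl /= catalan0 !mul1r subn0 -addrA; congr (_ + _).
  rewrite !mulr_sumr -sumrB; apply: eq_bigr => p _.
  rewrite [bump _ _]add1n subSS [LHS]mulrA catalanS natrD natrM -natr1; ring.
elim: k => [|k IH].
  have := catalanS R 0; rewrite big_ord1 !catalan0; lra.
have nz : k.+3%:R != 0 :> R by rewrite pnatr_eq0.
apply: (mulfI nz); rewrite catalanS -/(D k.+1) -TD TS.
have := TD k; rewrite /D IH => TDk.
rewrite mulrBr mulrDr -!(mulrCA 4) TDk natrD natrM -!natr1; ring.
Qed.

(** * A weighted l1 norm on polynomials *)

Section AbsPoly.
Variables (F : numFieldType) (r : F).
Hypothesis r_ge0 : 0 <= r.

(** The radius [r] lives in the coefficient field, so over [R[i]] it is a complex number, made real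
    by [0 <= r]. *)
Definition abs_horner (p : {poly F}) : F := \sum_(i < size p) `|p`_i| * r ^+ i.

Lemma abs_hornerE (N : nat) (p : {poly F}) : (size p <= N)%N ->
  abs_horner p = \sum_(i < N) `|p`_i| * r ^+ i.
Proof.
move=> le_pN; rewrite /abs_horner (big_ord_widen N (fun i => `|p`_i| * r ^+ i)) //.
rewrite [RHS](bigID (fun i : 'I_N => (i < size p)%N)) /= [X in _ + X]big1 ?addr0 //.
by move=> i; rewrite -leqNgt => /leq_sizeP -> //; rewrite normr0 mul0r.
Qed.

Lemma abs_horner_ge0 (p : {poly F}) : 0 <= abs_horner p.
Proof. by apply: sumr_ge0 => i _; rewrite mulr_ge0 ?exprn_ge0. Qed.

Lemma abs_horner0 : abs_horner 0 = 0.
Proof. by rewrite /abs_horner size_poly0 big_ord0. Qed.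

Lemma abs_hornerD (p q : {poly F}) :
  abs_horner (p + q) <= abs_horner p + abs_horner q.
Proof.
rewrite (abs_hornerE (size_polyD p q)) (abs_hornerE (leq_maxl (size p) (size q))).
rewrite (abs_hornerE (leq_maxr (size p) (size q))) -big_split /=.
by apply: ler_sum => i _; rewrite -mulrDl coefD ler_wpM2r ?exprn_ge0 ?ler_normD.
Qed.

Lemma abs_hornerN (p : {poly F}) : abs_horner (- p) = abs_horner p.
Proof.
by rewrite /abs_horner size_polyN; apply: eq_bigr => i _; rewrite coefN normrN.
Qed.

Lemma abs_horner_sum (I : Type) (s : seq I) (P : pred I) (f : I -> {poly F}) :
  abs_horner (\sum_(i <- s | P i) f i) <= \sum_(i <- s | P i) abs_horner (f i).
Proof.
elim/big_ind2: _ => [|x p y q hp hq|//]; first by rewrite abs_horner0.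
exact: le_trans (abs_hornerD _ _) (lerD hp hq).
Qed.

Lemma abs_hornerZ (c : F) (p : {poly F}) :
  abs_horner (c *: p) = `|c| * abs_horner p.
Proof.
rewrite (abs_hornerE (size_scale_leq c p)) /abs_horner mulr_sumr.
by apply: eq_bigr => i _; rewrite coefZ normrM mulrA.
Qed.

Lemma abs_hornerC (c : F) : abs_horner c%:P = `|c|.
Proof. by rewrite (abs_hornerE (size_polyC_leq1 c)) big_ord1 coefC expr0 mulr1. Qed.

Lemma abs_hornerMX (p : {poly F}) : abs_horner (p * 'X) = r * abs_horner p.
Proof.
have szp : (size (p * 'X)%R <= (size p).+1)%N.
  by apply: leq_trans (size_polyMleq _ _) _; rewrite size_polyX addn2.
rewrite (abs_hornerE szp) big_ord_recl coefMX normr0 mul0r add0r mulr_sumr.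
by apply: eq_bigr => i _; rewrite coefMX exprS mulrCA.
Qed.

(** Horner induction on [p] replaces the double sum over coefficients: a factor ['X] scales the norm
    by [r], and a constant [c] added to [p * 'X] adds exactly [|c|]. *)
Lemma abs_hornerM (p q : {poly F}) :
  abs_horner (p * q) <= abs_horner p * abs_horner q.
Proof.
elim/poly_ind: p => [|p c IH]; first by rewrite mul0r abs_horner0 mul0r.
have -> : abs_horner (p * 'X + c%:P) = r * abs_horner p + `|c|.
  have szp : (size (p * 'X + c%:P)%R <= (size p).+1)%N.
    by rewrite size_MXaddC; case: ifP.
  rewrite (abs_hornerE szp) big_ord_recl coefD coefMX coefC add0r expr0 mulr1 addrC.
  rewrite mulr_sumr; congr (_ + _); apply: eq_bigr => i _.
  by rewrite coefD coefMX coefC /= addr0 exprS mulrCA.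
rewrite mulrDl mulrAC mul_polyC; apply: le_trans (abs_hornerD _ _) _.
by rewrite abs_hornerMX abs_hornerZ [leRHS]mulrDl -mulrA lerD2r ler_wpM2l.
Qed.

Lemma abs_hornerX (p : {poly F}) (n : nat) :
  abs_horner (p ^+ n) <= abs_horner p ^+ n.
Proof.
elim: n => [|n IH]; first by rewrite !expr0 abs_hornerC normr1.
by rewrite !exprS (le_trans (abs_hornerM _ _)) // ler_wpM2l ?abs_horner_ge0.
Qed.

(** Only monomials of index [i >= d] survive, and there [s ^+ i <= s ^+ d] because [s <= 1]. This
    turns divisibility by ['X^d] into geometric decay. *)
Lemma norm_horner_le (d : nat) (p : {poly F}) (x s : F) :
  (forall i, (i < d)%N -> p`_i = 0) -> 0 <= s <= 1 -> `|x| <= s * r ->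
  `|p.[x]| <= s ^+ d * abs_horner p.
Proof.
move=> p0 /andP[s0 s1] xsr; rewrite horner_coef /abs_horner mulr_sumr.
apply: le_trans (ler_norm_sum _ _ _) _; apply: ler_sum => i _.
rewrite normrM normrX; have [id|di] := ltnP i d.
  by rewrite p0 // normr0 !mul0r mulr0.
rewrite mulrCA ler_wpM2l //.
apply: (@le_trans _ _ ((s * r) ^+ i)); first by rewrite lerXn2r ?nnegrE ?mulr_ge0.
by rewrite exprMn ler_wpM2r ?exprn_ge0 // ler_wiXn2l.
Qed.

End AbsPoly.

(** * Polynomial congruences and the rows of the matrix M *)

Lemma dvdXnP (F : fieldType) (q : nat) (p : {poly F}) :
  reflect (forall i, (i < q)%N -> p`_i = 0) ('X^q %| p)%R.
Proof.
rewrite dvdpE -[Pdiv.Ring.rdvdp _ _]/(Pdiv.CommonRing.rmodp p 'X^q == 0).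
rewrite -Pdiv.RingMonic.take_poly_rmodp; apply: (iffP eqP) => [p0 i iq|p0].
  by have := coef_take_poly q p i; rewrite p0 coef0 iq.
by apply/polyP => i; rewrite coef_take_poly coef0; case: ifP => // /p0.
Qed.

(* The entry of index (i, j) of the matrix M of the paper; for [0 < j < n] it
   vanishes at [i = 0] and [i = n]. *)
Definition Mcoef (F : fieldType) (n i j : nat) : F :=
  if (i <= j)%N then i%:R / n%:R else - ((n - i)%:R / n%:R).

Lemma McoefS (F : fieldType) (n i j : nat) : n%:R != 0 :> F -> (i < n)%N ->
  Mcoef F n i.+1 j - Mcoef F n i j = n%:R^-1 - (j == i)%:R.
Proof.
move=> n0 ltin; rewrite /Mcoef.
have -> : (n - i.+1)%:R = n%:R - i%:R - 1 :> F.
  by rewrite natrB // -natr1; ring.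
have -> : (n - i)%:R = n%:R - i%:R :> F by rewrite natrB // ltnW.
by rewrite -natr1; case: (ltngtP i j) => ij /=; field.
Qed.

Section PowerFamily.
Variables (F : fieldType) (n : nat) (h : nat -> {poly F}) (d : {poly F}).

(** Residual of row [i] of the linear system [h + h_1 M h = U h_n], where [h n] supplies the
    right-hand side. *)
Definition matrix_defect (i : nat) : {poly F} :=
  h i + h 1%N * (\sum_(1 <= j < n) Mcoef F n i j *: h j)
  - (i%:R / n%:R) *: h n.

Hypothesis n_neq0 : n%:R != 0 :> F.
Hypothesis h0 : h 0%N = 0.

(** Rows 0 and [n] of M vanish on the columns [1 <= j < n]. Adding these two trivial rows lets the
    differences of consecutive rows cover every step from 0 to [n]. *)
Lemma matrix_defect0 : matrix_defect 0 = 0.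
Proof.
rewrite /matrix_defect h0 !mul0r scale0r subr0 add0r big_nat_cond big1 ?mulr0 //.
by move=> j _; rewrite /Mcoef mul0r scale0r.
Qed.

Lemma matrix_defectn : matrix_defect n = 0.
Proof.
rewrite /matrix_defect divff // scale1r addrAC subrr add0r.
rewrite big_nat_cond big1 ?mulr0 // => j /andP[/andP[_ jn] _].
by rewrite /Mcoef leqNgt jn subnn mul0r oppr0 scale0r.
Qed.

Lemma matrix_defectB (i : nat) : (i < n)%N ->
  matrix_defect i.+1 - matrix_defect i
  = h i.+1 - h i + h 1%N * (n%:R^-1 *: (\sum_(1 <= j < n) h j) - h i)
    - n%:R^-1 *: h n.
Proof.
move=> ltin.
have -> : n%:R^-1 *: (\sum_(1 <= j < n) h j) - h i
    = \sum_(1 <= j < n) (Mcoef F n i.+1 j *: h j - Mcoef F n i j *: h j).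
  under [RHS]eq_bigr => j _ do rewrite -scalerBl McoefS // scalerBl.
  rewrite sumrB -scaler_sumr; congr (_ - _).
  have [->|i0] := posnP i.
    rewrite h0 big_nat_cond big1 // => j /andP[/andP[j0 _] _].
    by rewrite (gtn_eqF j0) scale0r.
  rewrite (bigD1_seq i) ?iota_uniq ?mem_index_iota ?i0 //= eqxx scale1r.
  by rewrite big1 ?addr0 // => j /negPf ->; rewrite scale0r.
rewrite sumrB /matrix_defect -natr1 (mulrDl i%:R) mul1r scalerDl; ring.
Qed.

(* Consecutive rows of M differ by 1/n, except for a -1 on the diagonal:
   subtracting consecutive rows of the linear system leaves
   h_(i+1) - h_i = h_1 h_i + h_1. *)
Lemma matrix_defect_step (i : nat) : (i < n)%N ->
  (1 + h i.+1) - (1 + h i) * (1 + h 1%N)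
  = matrix_defect i.+1 - matrix_defect i - matrix_defect 1%N.
Proof.
move=> ltin; have lt0n := leq_ltn_trans (leq0n i) ltin.
have d1 : matrix_defect 1 = h 1%N + h 1%N * (n%:R^-1 *: (\sum_(1 <= j < n) h j))
    - n%:R^-1 *: h n.
  by have := matrix_defectB lt0n; rewrite matrix_defect0 h0 !subr0.
rewrite matrix_defectB // d1; ring.
Qed.

(** Modulo [d] each step multiplies [1 + h i] by [1 + h 1]. The case [i = n] carries the equation,
    since [h n] will be its right-hand side minus 1. *)
Lemma power_family (i : nat) :
    (forall i, (0 < i < n)%N -> (d %| matrix_defect i)%R) ->
  (i <= n)%N -> (d %| (1 + h i) - (1 + h 1%N) ^+ i)%R.
Proof.
move=> defect0 lein.
have dvd j : (j <= n)%N -> (d %| matrix_defect j)%R.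
  rewrite leq_eqVlt => /predU1P[->|jn]; first by rewrite matrix_defectn dvdp0.
  have [->|j0] := posnP j; first by rewrite matrix_defect0 dvdp0.
  by rewrite defect0 ?j0.
elim: i lein => [|i IH] lein; first by rewrite h0 addr0 expr0 subrr dvdp0.
have -> : 1 + h i.+1 - (1 + h 1%N) ^+ i.+1
    = (matrix_defect i.+1 - matrix_defect i - matrix_defect 1%N)
      + (1 + h 1%N) * (1 + h i - (1 + h 1%N) ^+ i).
  by rewrite -matrix_defect_step // exprS; ring.
have n1 := leq_ltn_trans (leq0n i) lein.
apply: dvdp_add; last by rewrite dvdp_mull // IH // ltnW.
by rewrite (dvdp_sub (dvdp_sub _ _)) ?dvd // ltnW.
Qed.

End PowerFamily.

(** * The vectors W as coefficients of a formal solution *)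

(** Entry with the 1-based index of the mathematics, total in [i]: it is 0 outside [1..n-1]. *)
Definition centry (R : nmodType) (n : nat) (w : 'cV[R]_n.-1) (i : nat) : R :=
  \sum_(j < n.-1 | j.+1 == i) w j 0.

Lemma centryS (R : nmodType) (n : nat) (w : 'cV[R]_n.-1) (i : 'I_n.-1) :
  centry w i.+1 = w i 0.
Proof. exact: big_pred1_eq. Qed.

Lemma dotC_Avec (R : realType) (n : nat) (a : nat -> R[i]) (p : nat)
    (w : 'cV[R[i]]_n.-1) : dotC (Avec n a p) w = a p * centry w p.
Proof.
rewrite /dotC mxE /centry mulr_sumr [RHS]big_mkcond /=; apply: eq_bigr => j _.
by rewrite mxE; case: ifP; rewrite ?mul0r.
Qed.

Lemma dotC_uvec (R : realType) (n : nat) (w : 'cV[R[i]]_n.-1) :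
  dotC (uvec R n) w = centry w 1.
Proof.
rewrite /dotC mxE /centry [RHS]big_mkcond /=; apply: eq_bigr => j _.
by rewrite mxE; case: ifP; rewrite ?mul0r ?mul1r.
Qed.

Section FormalSolution.
Variables (R : realType) (n : nat) (a : nat -> R[i]).
Hypothesis n_ge2 : (2 <= n)%N.
Hypothesis a0_neq0 : a 0%N != 0.

(** Coefficient of [tau^(q-1)] in the series [g_i]: the degree is one less than the index of W. *)
Definition Wcoef (q i : nat) : R[i] := centry (Wseq n a q) i / a 0%N.

Lemma Wcoef1 (i : nat) : (0 < i < n)%N -> Wcoef 1 i = 1.
Proof.
case: i => // i lti; have lti' : (i < n.-1)%N by lia.
by rewrite /Wcoef (centryS _ (Ordinal lti')) W1E !mxE mulr1 divff.
Qed.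

Lemma WcoefE (q i : nat) : (2 <= q)%N -> (0 < i < n)%N ->
  Wcoef q i =
  - (\sum_(1 <= j < n) Mcoef R[i] n i j *
       \sum_(1 <= p < q.-1) Wcoef p.+1 1 * Wcoef (q - p) j)
  + i%:R / n%:R * \sum_(1 <= p < minn n q) a p / a 0%N * Wcoef (q - p) p.
Proof.
case: i => // i q2 lti; have lti' : (i < n.-1)%N by lia.
have -> : minn n q = (minn n.-1 q.-1).+1 by lia.
(* The separate initial value W(2) fits the general recursion: the convolution is empty and only
   [p = 1] remains in the second sum. *)
have [->|q_neq2] := eqVneq q 2%N.
  rewrite [X in - X]big1 ?oppr0 ?add0r => [|j _]; last by rewrite big_geq ?mulr0.
  have -> : minn n.-1 2.-1 = 1%N by lia.
  rewrite big_nat1 Wcoef1 // mulr1 /Wcoef (centryS _ (Ordinal lti')) W2E !mxE /=.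
  by ring.
rewrite {1}/Wcoef (centryS _ (Ordinal lti')) WE; last by lia.
rewrite mxE [((_ *m _) + _) _ _]mxE [(_ *: Uvec R n) _ _]mxE [Uvec _ _ _ _]mxE [(_ *m _) _ _]mxE.
(* In terms of [Wcoef] and [a_p / a_0] both sums carry [a 0 ^+ 2]: one factor cancels against the
   [1 / a_0] of the recursion, the other against that of [Wcoef]. *)
have -> : \sum_j (- map_mx (real_complex R) (Mmx R n)) (Ordinal lti') j *
      (\sum_(1 <= p < q.-1) dotC (uvec R n) (Wseq n a p.+1) *: Wseq n a (q - p)) j 0
  = - (a 0%N ^+ 2 * \sum_(1 <= j < n) Mcoef R[i] n i.+1 j *
       \sum_(1 <= p < q.-1) Wcoef p.+1 1 * Wcoef (q - p) j).
  rewrite mulr_sumr [X in _ = - X]big_add1 [X in _ = - X]big_mkord -sumrN.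
  apply: eq_bigr => j _; rewrite !mxE summxE mulNr; congr (- _).
  rewrite [RHS]mulrCA [X in _ = _ * X]mulr_sumr; congr (_ * _).
    rewrite /Mcoef ltnS; case: ifP => _.
      by rewrite rmorphM fmorphV !rmorph_nat.
    by rewrite rmorphN rmorphM fmorphV !rmorph_nat.
  apply: eq_bigr => p _; rewrite mxE dotC_uvec /Wcoef (centryS _ j); field.
  by [].
have -> : \sum_(1 <= p < (minn n.-1 q.-1).+1) dotC (Avec n a p) (Wseq n a (q - p))
  = a 0%N ^+ 2 * \sum_(1 <= p < (minn n.-1 q.-1).+1) a p / a 0%N * Wcoef (q - p) p.
  rewrite mulr_sumr; apply: eq_bigr => p _; rewrite dotC_Avec /Wcoef; field.
  by [].
by field; rewrite a0_neq0 pnatr_eq0 /=; lia.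
Qed.

Definition Wpoly (q i : nat) : {poly R[i]} := \poly_(m < q) Wcoef m.+1 i.

(* The [i]-th entry of the vector generating function of W / a_0, minus 1, cut
   at degree q; the entry n stands for w^n - 1, as read off the equation. *)
Definition Wshift (q i : nat) : {poly R[i]} :=
  if i == 0%N then 0
  else if i == n then \sum_(1 <= p < n) (a p / a 0%N) *: ('X^p * Wpoly q p)
  else Wpoly q i - 1.

Lemma coef_Wshift (q i m : nat) : (m < q)%N -> (0 < i < n)%N ->
  (Wshift q i)`_m = if m == 0%N then 0 else Wcoef m.+1 i.
Proof.
move=> mq /andP[i0 lti]; rewrite /Wshift gtn_eqF // ltn_eqF //.
rewrite coefB coef_poly mq coef1; case: eqP => [->|_]; last by rewrite subr0.
by rewrite Wcoef1 ?i0 // subrr.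
Qed.

Lemma coef_Wshiftn (q m : nat) : (m < q)%N ->
  (Wshift q n)`_m = \sum_(1 <= p < minn n m.+1) a p / a 0%N * Wcoef (m.+1 - p) p.
Proof.
move=> mq; rewrite /Wshift eqxx gtn_eqF ?(ltn_trans _ n_ge2) // coef_sum.
rewrite [RHS](big_nat_widen _ _ n) ?geq_minl // [RHS]big_mkcond /=.
apply: eq_big_nat => p /andP[p0 pn].
rewrite coefZ coefXnM coef_poly leq_min pn /= ltnS.
have [mp|pm] := ltnP m p; first by rewrite mulr0.
by rewrite subSn // (leq_ltn_trans (leq_subr _ _) mq).
Qed.

(** In degree [m < q] the truncation is invisible, and the coefficient of the defect vanishes by the
    recursion for [Wcoef] at [m + 1]. *)
Lemma dvd_Wshift_defect (q i : nat) : (0 < i < n)%N ->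
  ('X^q %| matrix_defect n (Wshift q) i)%R.
Proof.
move=> lti; apply/dvdXnP => m mq.
have n1 : (0 < 1 < n)%N by [].
rewrite /matrix_defect coefB coefD coefZ coef_Wshiftn // coefM coef_Wshift //.
(* Neither factor has a constant term, so the Cauchy product loses its end terms [p = 0] and
   [p = m], as in the recursion. *)
have -> : \sum_(p < m.+1) (Wshift q 1)`_p *
      (\sum_(1 <= j < n) Mcoef R[i] n i j *: Wshift q j)`_(m - p)
    = \sum_(1 <= j < n) Mcoef R[i] n i j *
       \sum_(1 <= p < m) Wcoef p.+1 1 * Wcoef (m.+1 - p) j.
  under eq_bigr => p _ do rewrite coef_sum mulr_sumr.
  rewrite exchange_big /=; apply: eq_big_nat => j ltj.
  rewrite mulr_sumr [RHS](big_nat_widen _ _ m.+1) // big_mkcond /=.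
  rewrite [RHS](big_nat_widenl _ 0) // big_mkcond big_mkord; apply: eq_bigr => p _.
  have pm : (p <= m)%N by rewrite -ltnS.
  rewrite coefZ !coef_Wshift ?(leq_ltn_trans _ mq) ?leq_subr // mulrCA.
  rewrite subn_eq0 lt0n leqNgt -subSn //.
  by case: eqP => /=; case: ltnP => /=; rewrite ?mul0r ?mulr0.
case: eqP => [->|/eqP m0]; last first.
  rewrite (WcoefE (q := m.+1)) //=; last by rewrite ltnS lt0n.
  by ring.
rewrite add0r big1 ?sub0r => [|j _]; last by rewrite big_geq ?mulr0.
by rewrite big_geq ?mulr0 ?oppr0 // (leq_trans (geq_minr _ _)).
Qed.

Definition root_defect (p : {poly R[i]}) : {poly R[i]} :=
  p ^+ n - (1 + \sum_(1 <= j < n) (a j / a 0%N) *: ('X^j * p ^+ j)).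

Lemma dvd_root_defect (q : nat) : (0 < q)%N -> ('X^q %| root_defect (Wpoly q 1))%R.
Proof.
move=> q0.
have nz : n%:R != 0 :> R[i] by rewrite pnatr_eq0; lia.
have h0 : Wshift q 0 = 0 by [].
have hE i : (0 < i < n)%N -> 1 + Wshift q i = Wpoly q i.
  by case/andP=> i0 lti; rewrite /Wshift gtn_eqF // ltn_eqF // addrC subrK.
have pf i := power_family nz h0 (i := i) (@dvd_Wshift_defect q).
(* [Wshift q n] is built from the [Wpoly q j], not from powers of [Wpoly q 1]. The sum corrects this
   term by term, and [power_family] makes each correction divisible by ['X^q]. *)
have -> : root_defect (Wpoly q 1) =
    \sum_(1 <= j < n) (a j / a 0%N) *: ('X^j * (Wpoly q j - Wpoly q 1 ^+ j))
    - (1 + Wshift q n - Wpoly q 1 ^+ n).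
  rewrite /root_defect {1}/Wshift eqxx gtn_eqF ?(ltn_trans _ n_ge2) //.
  under [X in _ = X - _]eq_bigr => j _ do rewrite mulrBr scalerBr.
  by rewrite sumrB; ring.
rewrite dvdp_sub //; last by rewrite -(hE 1%N) ?pf.
rewrite big_nat_cond; elim/big_ind: _ => [|x y|j /andP[lj _]].
- exact: dvdp0.
- exact: dvdp_add.
rewrite -mul_polyC !dvdp_mull // -!hE // pf //.
by case/andP: lj => _ /ltnW.
Qed.

End FormalSolution.

(** * Modulus, complex exponential and complex series *)

Section ModC.
Variable R : realType.
Implicit Types z w : R[i].

Lemma normC_modC z : `|z| = (modC z)%:C. Proof. by []. Qed.

Lemma modC_ge0 z : 0 <= modC z.
Proof. by case: z => x y; exact: sqrtr_ge0. Qed.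

Lemma modCM z w : modC (z * w) = modC z * modC w.
Proof. exact: ComplexField.Normc.normcM. Qed.

Lemma modCX z (n : nat) : modC (z ^+ n) = modC z ^+ n.
Proof. by apply: complexI; rewrite rmorphXn -!normC_modC normrX. Qed.

Lemma modCV z : modC z^-1 = (modC z)^-1.
Proof. exact: ComplexField.Normc.normcV. Qed.

Lemma modCN z : modC (- z) = modC z.
Proof. by apply: complexI; rewrite -!normC_modC normrN. Qed.

Lemma modCD z w : modC (z + w) <= modC z + modC w.
Proof. by rewrite -lecR rmorphD -!normC_modC ler_normD. Qed.

Lemma modC_sum (I : Type) (s : seq I) (P : pred I) (F : I -> R[i]) :
  modC (\sum_(i <- s | P i) F i) <= \sum_(i <- s | P i) modC (F i).
Proof. by rewrite -lecR rmorph_sum -normC_modC ler_norm_sum. Qed.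

Lemma modC_real (x : R) : modC x%:C = `|x|.
Proof. by rewrite /modC /= expr0n addr0 sqrtr_sqr. Qed.

Lemma modC_nat (n : nat) : modC (n%:R : R[i]) = n%:R.
Proof. by rewrite -(rmorph_nat (real_complex R)) modC_real normr_nat. Qed.

Lemma modC_expi (x : R) : modC (expi x) = 1.
Proof. by rewrite /modC /= cos2Dsin2 sqrtr1. Qed.

Lemma Re_le_modC z : `|complex.Re z| <= modC z.
Proof. by rewrite -lecR -normC_modC normc_ge_Re. Qed.

Lemma Im_le_modC z : `|complex.Im z| <= modC z.
Proof.
case: z => x y; rewrite /modC /= -[leLHS]sqrtr_sqr.
by rewrite ler_sqrt ?addr_ge0 ?sqr_ge0 // lerDr sqr_ge0.
Qed.

Lemma modC_le_ReIm z : modC z <= `|complex.Re z| + `|complex.Im z|.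
Proof.
case: z => x y; have -> : x +i* y = x%:C + (0 +i* 1) * y%:C.
  by apply/eqP; rewrite eq_complex /=; apply/andP; split; apply/eqP; ring.
have i1 : modC (0 +i* 1 : R[i]) = 1 by rewrite /modC /= expr0n expr1n add0r sqrtr1.
rewrite (le_trans (modCD _ _)) // modCM !modC_real i1 mul1r.
by rewrite /= !mul0r !mul1r ?mulr0 ?addr0 ?add0r ?subr0.
Qed.

Lemma expiD (x y : R) : expi (x + y) = expi x * expi y.
Proof.
apply/eqP; rewrite eq_complex /= cosD sinD.
by apply/andP; split; apply/eqP; ring.
Qed.

Lemma expi0 : expi 0 = 1 :> R[i].
Proof. by rewrite /expi cos0 sin0. Qed.

Lemma expiMn (x : R) (n : nat) : expi (n%:R * x) = expi x ^+ n.
Proof.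
elim: n => [|n IH]; first by rewrite mul0r expi0.
by rewrite -natr1 mulrDl mul1r expiD IH exprSr.
Qed.

Lemma expi_2pi (k : nat) : expi (k%:R * (2 * pi)) = 1 :> R[i].
Proof.
by rewrite expiMn /expi mulr_natl cos2pi sin2pi expr1n.
Qed.

Lemma cvg_modC (f : nat -> R[i]) (l : R[i]) (u : nat -> R) :
  (forall q, modC (l - f q) <= u q) -> u @ \oo --> 0 ->
  f @ \oo --> (l : R[i]^o).
Proof.
move=> fu u0; apply/(@cvgrPdist_lt R[i] R[i]^o nat \oo _ f l) => e; case: e => e e' e0.
(* A positive element of [R[i]] has zero imaginary part, so the tolerance is the real number [e]. *)
have : 0 < e by move: e0; rewrite ltcE /= => /andP[].
have -> : e' = 0 by move: e0; rewrite ltcE /= => /andP[/eqP].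
move=> {e0} e0; near=> q; rewrite [`| _ |]normC_modC ltcR.
apply: le_lt_trans (fu q) _; apply: le_lt_trans (ler_norm _) _.
by rewrite -normrN -sub0r; near: q; exact: cvgr_dist_lt.
Unshelve. all: by end_near. Qed.

Lemma bounded_sum_cvg (u : nat -> R) (K : R) : (forall m, 0 <= u m.+1) ->
  (forall q, \sum_(1 <= m < q.+1) u m <= K) ->
  cvgn (fun q => \sum_(1 <= m < q.+1) u m).
Proof.
move=> u0 uK; apply: nondecreasing_is_cvgn; last by exists K => _ [q _ <-].
apply/nondecreasing_seqP => q.
by rewrite [leRHS]big_nat_recr //= lerDl.
Qed.

Lemma geometric_sum_le (u : nat -> R) (K s : R) : 0 <= s < 1 ->
  (forall m, 0 <= u m.+1 <= K * s ^+ m) ->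
  forall q, \sum_(1 <= m < q.+1) u m <= K / (1 - s).
Proof.
move=> /andP[s0 s1] uK q.
have K0 : 0 <= K by have /andP[/le_trans h /h] := uK 0; rewrite expr0 mulr1.
apply: (@le_trans _ _ (\sum_(m < q) K * s ^+ m)).
  by rewrite big_add1 big_mkord; apply: ler_sum => m _; case/andP: (uK m).
rewrite -mulr_sumr ler_wpM2l // -div1r ler_pdivlMr ?subr_gt0 //.
rewrite mulrC -opprB mulNr -subrX1 opprB.
by rewrite lerBlDr lerDl exprn_ge0.
Qed.

(** Meant for the real and imaginary parts, which the modulus dominates: absolute convergence passes
    to them by comparison of real series. *)
Lemma abs_cvg_part (c : nat -> R[i]) (f : R[i] -> R) :
    f 0 = 0 -> {morph f : z w / z + w} -> (forall z, `|f z| <= modC z) ->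
  cvgn (fun q => \sum_(1 <= m < q.+1) modC (c m)) ->
  cvgn (fun q => f (\sum_(1 <= m < q.+1) c m)).
Proof.
move=> f0 fD fle cc; have -> : (fun q => f (\sum_(1 <= m < q.+1) c m))
    = series (fun m => f (c m.+1)).
  by apply/funext => q; rewrite big_add1 (big_morph f fD f0).
apply: normed_cvg; apply: (@series_le_cvg _ _ (fun m => modC (c m.+1))).
- by move=> m; exact: normr_ge0.
- by move=> m; exact: modC_ge0.
- by move=> m; exact: fle.
suff -> : series (fun m => modC (c m.+1))
  = (fun q => \sum_(1 <= m < q.+1) modC (c m)) by [].
apply/funext => q; by rewrite /series /= big_add1.
Qed.

Lemma abs_cvg_complex (c : nat -> R[i]) :
  cvgn (fun q => \sum_(1 <= m < q.+1) modC (c m)) ->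
  cvgn ((fun q => \sum_(1 <= m < q.+1) c m) : nat -> R[i]^o).
Proof.
move=> cc.
have ReD : {morph (@complex.Re R) : z w / z + w} by case=> ? ? [].
have ImD : {morph (@complex.Im R) : z w / z + w} by case=> ? ? [].
have /cvg_ex[/= x cx] := abs_cvg_part (erefl _) ReD Re_le_modC cc.
have /cvg_ex[/= y cy] := abs_cvg_part (erefl _) ImD Im_le_modC cc.
apply/cvg_ex; exists (x +i* y).
set f := fun q => _.
apply: (@cvg_modC _ _ (fun q => `|x - complex.Re (f q)| + `|y - complex.Im (f q)|)).
  by move=> q; apply: le_trans (modC_le_ReIm _) _; case: (f q).
have c0 (v : nat -> R) (l : R) : v @ \oo --> l -> (fun q => `|l - v q|) @ \oo --> 0.
  move=> vl; rewrite -(@normr0 _ R) -(subrr l).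
  by apply: cvg_norm; apply: cvgB => //; exact: cvg_cst.
by rewrite -[0]addr0; apply: cvgD; exact: c0.
Qed.

(** Abel's argument: at a point [z] of convergence with [|t| < |z|] the terms are bounded, hence a
    radius below [|z|] gives a geometrically dominated series. Keeping [r] strictly above [|t|]
    provides the decay ratio [|t| / r]. *)
Lemma conv_radius_bound (c : nat -> R[i]) (t : R) :
  (`|t|%:E < conv_radius c)%E ->
  exists r K, `|t| < r /\ forall q, \sum_(1 <= m < q.+1) modC (c m) * r ^+ m <= K.
Proof.
move=> /ereal_sup_gt[_ [z /= cz <-]]; rewrite lte_fin => tz.
have z0 : 0 < modC z := le_lt_trans (normr_ge0 t) tz.
have [M M0 bM] : exists2 M : R, 0 <= M &
    forall q, modC (\sum_(1 <= m < q.+1) c m * z ^+ m) <= M.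
  have := @cvg_seq_bounded _ _ _ cz; rewrite /bounded_fun /bounded_near.
  move=> [M [Mreal hM]].
  have /hM h : M < M + 1 by rewrite ltrDl.
  (* The bound coming from convergence is itself an element of [R[i]]; taking a modulus makes it
     real. *)
  exists (modC (M + 1)) => [|q]; first exact: modC_ge0.
  have := h q I; rewrite /= => h'.
  rewrite -lecR -!normC_modC; apply: le_trans h' _.
  by apply: real_ler_norm; rewrite realD ?real1.
have cM m : modC (c m.+1) * modC z ^+ m.+1 <= M + M.
  rewrite -modCX -modCM.
  have -> : c m.+1 * z ^+ m.+1 = \sum_(1 <= k < m.+2) c k * z ^+ k
     - \sum_(1 <= k < m.+1) c k * z ^+ k by rewrite [in RHS]big_nat_recr //= addrAC subrr add0r.
  by rewrite (le_trans (modCD _ _)) // modCN lerD.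
pose r := (`|t| + modC z) / 2; exists r.
have tr : `|t| < r by rewrite /r; lra.
have rz : r < modC z by rewrite /r; lra.
have r0 : 0 <= r by apply: le_trans (normr_ge0 t) (ltW tr).
pose s := r / modC z.
have s01 : 0 <= s < 1 by rewrite divr_ge0 ?modC_ge0 //= ltr_pdivrMr // mul1r.
exists ((M + M) / (1 - s)); split=> //.
apply: geometric_sum_le => // m; rewrite mulr_ge0 ?modC_ge0 ?exprn_ge0 //=.
have -> : r ^+ m.+1 = modC z ^+ m.+1 * s ^+ m.+1.
  by rewrite -exprMn /s mulrC divfK ?gt_eqF.
rewrite mulrA; apply: ler_pM => //.
- by rewrite mulr_ge0 ?modC_ge0 ?exprn_ge0 ?modC_ge0.
- by case/andP: s01 => *; rewrite exprn_ge0.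
by case/andP: s01 => ? s1; rewrite exprS ler_piMl ?exprn_ge0 // ltW.
Qed.

End ModC.

(** * Evaluating the formal defect at tau *)

Section Evaluation.
Variables (R : realType) (n : nat) (a : nat -> R[i]).
Hypothesis n_ge2 : (2 <= n)%N.
Hypothesis a0_neq0 : a 0%N != 0.

(** With [x = tau w] and [t^n = tau^n / a_0], each [a_j x^j t^n] becomes
    [tau^n (a_j / a_0) tau^j w^j], so [tau^n] factors out. *)
Lemma Eres_root_defect (t : R) (tau : R[i]) (p : {poly R[i]}) :
  tau ^+ n = a 0%N * t%:C ^+ n ->
  Eres n a t (tau * p.[tau]) = tau ^+ n * (root_defect n a p).[tau].
Proof.
move=> tauE; rewrite /Eres /root_defect !hornerE horner_sum exprMn mulrBr; congr (_ - _).
rewrite -(big_mkord xpredT (fun j => a j * (tau * p.[tau]) ^+ j)).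
rewrite big_ltn ?(ltn_trans _ n_ge2) // expr0 mulr1.
have -> : \sum_(1 <= j < n) a j * (tau * p.[tau]) ^+ j
    = a 0%N * \sum_(1 <= j < n) ((a j / a 0%N) *: ('X^j * p ^+ j)).[tau].
  rewrite mulr_sumr; apply: eq_bigr => j _.
  by rewrite hornerZ hornerM hornerXn horner_exp exprMn; field.
by rewrite tauE; ring.
Qed.

(** The right-hand side depends on [p] only through [K], hence is uniform over all truncations of
    the series. *)
Lemma abs_horner_root_defect (r K : R[i]) (p : {poly R[i]}) : 0 <= r ->
  abs_horner r p <= K ->
  abs_horner r (root_defect n a p)
  <= K ^+ n + (1 + \sum_(1 <= j < n) `|a j / a 0%N| * (r * K) ^+ j).
Proof.
move=> r0 pK; have p0 := abs_horner_ge0 r0 p.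
have K0 : 0 <= K := le_trans p0 pK.
rewrite /root_defect (le_trans (abs_hornerD r0 _ _)) // abs_hornerN lerD //.
  by rewrite (le_trans (abs_hornerX r0 _ _)) // lerXn2r.
rewrite (le_trans (abs_hornerD r0 _ _)) // lerD //.
  by rewrite (_ : 1 = 1%:P) // abs_hornerC normr1.
rewrite (le_trans (abs_horner_sum r0 _ _ _)) //; apply: ler_sum => j _.
rewrite abs_hornerZ ler_wpM2l // -exprMn (le_trans (abs_hornerX r0 _ _)) //.
by rewrite mulrC abs_hornerMX lerXn2r ?nnegrE ?mulr_ge0 // ler_wpM2l.
Qed.

Lemma Eres_cvg0 (t s r : R) (tau : R[i]) (K : R) :
    tau ^+ n = a 0%N * t%:C ^+ n -> 0 <= s < 1 -> 0 <= r -> modC tau = s * r ->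
    (forall q, abs_horner r%:C (Wpoly n a q 1) <= K%:C) ->
  (fun q => Eres n a t (tau * (Wpoly n a q 1).[tau])) @ \oo --> (0 : R[i]^o).
Proof.
move=> tauE /andP[s0 s1] r0 tausr WK.
pose B := K ^+ n + (1 + \sum_(1 <= j < n) modC (a j / a 0%N) * (r * K) ^+ j).
have rC0 : 0 <= r%:C by rewrite -[0]/(0%:C) lecR.
have DB q : abs_horner r%:C (root_defect n a (Wpoly n a q 1)) <= B%:C.
  apply: le_trans (abs_horner_root_defect rC0 (WK q)) _.
  rewrite /B !rmorphD rmorphXn rmorph1 rmorph_sum /= lerD2l lerD2l ler_sum // => j _.
  by rewrite rmorphM rmorphXn rmorphM.
apply: (@cvg_modC _ _ _ (geometric (modC tau ^+ n * B) s)); last first.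
  by apply: cvg_geometric; rewrite ger0_norm.
move=> q; rewrite sub0r modCN Eres_root_defect // modCM modCX /=.
rewrite -mulrA ler_wpM2l ?exprn_ge0 ?modC_ge0 //.
rewrite -lecR -normC_modC mulrC rmorphM rmorphXn /=.
apply: le_trans (ler_wpM2l _ (DB q)); last by rewrite exprn_ge0 // -[0]/(0%:C) lecR.
apply: norm_horner_le => //.
- apply/dvdXnP; case: q => [|q]; first by rewrite expr0 dvd1p.
  exact: dvd_root_defect.
- by rewrite -[0]/(0%:C) -[1]/(1%:C) !lecR s0 ltW.
- by rewrite normC_modC tausr rmorphM.
Qed.

End Evaluation.

(** * Choice of tau and identification of the partial sums *)

Section Scaling.
Variables (R : realType) (n : nat) (a : nat -> R[i]) (rho theta : R).
Hypothesis n_ge2 : (2 <= n)%N.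
Hypothesis rho_gt0 : 0 < rho.
Hypothesis a0E : a 0%N = rho%:C * expi theta.

Let n_neq0 : n%:R != 0 :> R.
Proof. by rewrite pnatr_eq0; case: n n_ge2. Qed.

Definition root_a0 : R[i] := (rho `^ n%:R^-1)%:C * expi (theta / n%:R).

Lemma modC_a0 : modC (a 0%N) = rho.
Proof. by rewrite a0E modCM modC_real modC_expi mulr1 gtr0_norm. Qed.

Lemma a0_neq0 : a 0%N != 0.
Proof.
apply/eqP => a00; have := modC_a0; rewrite a00 -[0]/(0%:C) modC_real normr0.
by move/eqP; rewrite lt_eqF.
Qed.

Lemma modC_root_a0 : modC root_a0 = rho `^ n%:R^-1.
Proof. by rewrite modCM modC_real modC_expi mulr1 ger0_norm ?powR_ge0. Qed.

Lemma root_a0X (m : nat) :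
  root_a0 ^+ m = (rho `^ (m%:R / n%:R))%:C * expi (m%:R * theta / n%:R).
Proof.
rewrite exprMn -expiMn -rmorphXn /= mulrA; congr (_%:C * _).
by rewrite mulrC powRrM powR_mulrn ?powR_ge0.
Qed.

Lemma root_a0Xn : root_a0 ^+ n = a 0%N.
Proof. by rewrite root_a0X divff // powRr1 ?ltW // mulrAC divff // mul1r a0E. Qed.

Lemma betaE (m : nat) : beta n a rho theta m = root_a0 ^+ m * Wcoef n a m 1.
Proof. by rewrite /beta dotC_uvec root_a0X. Qed.

(** For [k < n] these are the solutions tau of [tau^n = a_0 t^n]. *)
Definition root_param (t : R) (k : nat) : R[i] :=
  root_a0 * expi (2 * k%:R * pi / n%:R) * t%:C.

Lemma root_paramXn (t : R) (k : nat) : root_param t k ^+ n = a 0%N * t%:C ^+ n.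
Proof.
rewrite 2!exprMn root_a0Xn -expiMn.
have -> : n%:R * (2 * k%:R * pi / n%:R) = k%:R * (2 * pi) :> R by field.
by rewrite expi_2pi mulr1.
Qed.

Lemma modC_root_param (t : R) (k : nat) :
  modC (root_param t k) = rho `^ n%:R^-1 * `|t|.
Proof. by rewrite 2!modCM modC_root_a0 modC_expi modC_real mulr1. Qed.

(** The factor in front makes up for a degree shift: [beta] at [m] carries the power [m] of
    [root_a0], while [Wcoef] at [m] sits in degree [m - 1]. *)
Lemma xpartE (t : R) (k q : nat) :
  xpart n a rho theta t k q = root_param t k * (Wpoly n a q 1).[root_param t k].
Proof.
rewrite /xpart horner_poly mulr_sumr big_add1 big_mkord; apply: eq_bigr => m _.
rewrite betaE [RHS]mulrCA -[_ * _ ^+ m]exprS /root_param 2![in RHS]exprMn -expiMn.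
by rewrite (_ : m.+1%:R * _ = 2 * k%:R * pi * m.+1%:R / n%:R); ring.
Qed.

Lemma root_a0_gt0 : 0 < rho `^ n%:R^-1.
Proof. exact: powR_gt0. Qed.

(** A radius [r] in [t] is the radius [rho^(1/n) r] in tau; the same degree shift divides the bound
    by it. *)
Lemma abs_horner_Wpoly (r K : R) : 0 < r ->
    (forall q, \sum_(1 <= m < q.+1) modC (beta n a rho theta m) * r ^+ m <= K) ->
  forall q, abs_horner (rho `^ n%:R^-1 * r)%:C (Wpoly n a q 1)
    <= (K / (rho `^ n%:R^-1 * r))%:C.
Proof.
move=> r0 hK q; set c := rho `^ n%:R^-1 * r.
have c0 : 0 < c by rewrite mulr_gt0 // root_a0_gt0.
rewrite (abs_hornerE _ (size_poly q _)).
have -> : \sum_(i < q) `|(Wpoly n a q 1)`_i| * c%:C ^+ i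
    = (\sum_(i < q) modC (Wcoef n a i.+1 1) * c ^+ i)%:C.
  rewrite rmorph_sum; apply: eq_bigr => i _.
  by rewrite coef_poly ltn_ord [RHS]rmorphM [X in _ = _ * X]rmorphXn.
rewrite lecR ler_pdivlMr // (le_trans _ (hK q)) // big_add1 big_mkord mulr_suml.
apply: ler_sum => i _.
rewrite -[leLHS]mulrA -exprSr /c exprMn betaE modCM modCX modC_root_a0.
by rewrite [leLHS]mulrCA [leLHS]mulrA.
Qed.

Lemma Eres_xpart_cvg0 (t : R) (k : nat) : (`|t|%:E < RC n a rho theta)%E ->
  (fun q => Eres n a t (xpart n a rho theta t k q)) @ \oo --> (0 : R[i]^o).
Proof.
move=> /conv_radius_bound[r [K [tr hK]]].
have r0 : 0 < r := le_lt_trans (normr_ge0 t) tr.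
under eq_fun do rewrite xpartE.
apply: (Eres_cvg0 n_ge2 a0_neq0 (root_paramXn t k) (s := `|t| / r)
  (r := rho `^ n%:R^-1 * r) _ _ _ (abs_horner_Wpoly r0 hK)).
- by rewrite divr_ge0 ?(ltW r0) //= ltr_pdivrMr // mul1r.
- by rewrite mulr_ge0 ?powR_ge0 ?ltW.
by rewrite modC_root_param mulrCA divfK ?gt_eqF.
Qed.

Lemma abs_cvg_RC (t : R) : (`|t|%:E < RC n a rho theta)%E ->
  cvgn (fun q => \sum_(1 <= m < q.+1) modC (beta n a rho theta m * t%:C ^+ m)).
Proof.
move=> /conv_radius_bound[r [K [tr hK]]].
apply: (@bounded_sum_cvg _ _ K) => [m|q]; first exact: modC_ge0.
apply: le_trans (hK q); apply: ler_sum => m _.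
rewrite modCM modCX modC_real ler_wpM2l ?modC_ge0 // lerXn2r ?nnegrE //.
  by apply: le_trans (ltW tr).
exact: ltW.
Qed.

Lemma xpart_cvg (t : R) (k : nat) : (`|t|%:E < RC n a rho theta)%E ->
  cvgn (xpart n a rho theta t k : nat -> R[i]^o).
Proof.
move=> /abs_cvg_RC tRC; apply: abs_cvg_complex.
rewrite (_ : (fun q => _) = fun q =>
  \sum_(1 <= m < q.+1) modC (beta n a rho theta m * t%:C ^+ m)) //.
apply/funext => q; apply: eq_bigr => m _.
by rewrite 2![in LHS]modCM modC_expi mulr1 [RHS]modCM.
Qed.

End Scaling.

(** * Majorants for the vectors W *)

Section Majorant.
Variables (R : realType) (n : nat) (a : nat -> R[i]).
Hypothesis n_ge2 : (2 <= n)%N.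

Local Notation N := (normM R n).
Local Notation al := (alpha n a).
Local Notation r0 := (modC (a 0%N)).

Lemma alpha_ge0 : 0 <= al.
Proof. exact: bigmax_ge_id. Qed.

Lemma modC_le_alpha (p : nat) : (1 <= p < n)%N -> modC (a p) <= al.
Proof.
move=> ltp; apply: (@le_bigmax_seq _ _ _ _ _ p xpredT (fun k => modC (a k))) => //.
by rewrite mem_index_iota.
Qed.

Lemma sum_modC_Mcoef_le (i : nat) : (0 < i < n)%N ->
  \sum_(1 <= j < n) modC (Mcoef R[i] n i j) <= N.
Proof.
case: i => // i lti; have lti' : (i < n.-1)%N by lia.
apply: le_trans (le_bigmax _ _ (Ordinal lti')).
rewrite big_add1 big_mkord; apply: ler_sum => j _; rewrite mxE /= /Mcoef ltnS.
by case: ifP => _; rewrite ?modCN modCM modCV !modC_nat ?normrN ger0_norm.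
Qed.

Lemma normM_gt0 : 0 < N.
Proof.
have lt1 : (0 < 1 < n)%N by [].
apply: lt_le_trans (sum_modC_Mcoef_le lt1).
rewrite big_ltn //; apply: ltr_wpDr; first by rewrite sumr_ge0 // => j _; exact: modC_ge0.
rewrite /Mcoef /= modCM modCV !modC_nat mul1r invr_gt0 ltr0n; exact: ltn_trans n_ge2.
Qed.

Hypothesis a0_neq0 : a 0%N != 0.

Lemma modC_gt0 : 0 < r0.
Proof.
rewrite lt0r modC_ge0 andbT; apply: contra a0_neq0 => /eqP.
by move/(@ComplexField.Normc.eq0_normc R)/eqP.
Qed.

Lemma Wcoef_step (Y : nat -> R) (k i : nat) : (1 <= k)%N -> (0 < i < n)%N ->
    (forall p j, (p < k)%N -> (0 < j < n)%N -> modC (Wcoef n a p.+1 j) <= Y p) ->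
  modC (Wcoef n a k.+1 i) <=
    N * (\sum_(1 <= p < k) Y p * Y (k - p)%N)
    + al / r0 * \sum_(1 <= p < minn n k.+1) Y (k - p)%N.
Proof.
move=> k1 lti hY.
have lt1 : (0 < 1 < n)%N by [].
have Y0 p : (p < k)%N -> 0 <= Y p.
  by move=> pk; apply: le_trans (modC_ge0 _) (hY p _ pk lt1).
rewrite WcoefE //= (le_trans (modCD _ _)) // modCN lerD //.
  rewrite (le_trans (modC_sum _ _ _)) //.
  apply: (@le_trans _ _ (\sum_(1 <= j < n) modC (Mcoef R[i] n i j) *
      \sum_(1 <= p < k) Y p * Y (k - p)%N)).
    rewrite big_nat_cond [leRHS]big_nat_cond; apply: ler_sum => j /andP[ltj _].
    rewrite modCM ler_wpM2l ?modC_ge0 // (le_trans (modC_sum _ _ _)) //.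
    rewrite big_nat_cond [leRHS]big_nat_cond; apply: ler_sum => p /andP[/andP[p1 pk] _].
    rewrite modCM ler_pM ?modC_ge0 ?hY // subSn ?hY //; last exact: ltnW.
    by rewrite ltn_subrL p1.
  rewrite -mulr_suml ler_wpM2r ?sum_modC_Mcoef_le //.
  rewrite big_nat_cond sumr_ge0 // => p /andP[/andP[p1 pk] _].
  by rewrite mulr_ge0 ?Y0 // ltn_subrL p1.
rewrite modCM modCM modCV !modC_nat -[leRHS]mul1r ler_pM //.
- exact: modC_ge0.
- by rewrite ler_pdivrMr ?mul1r ?ler_nat ?ltr0n; case/andP: lti => _ ltin; lia.
rewrite (le_trans (modC_sum _ _ _)) // mulr_sumr.
rewrite big_nat_cond [leRHS]big_nat_cond; apply: ler_sum => p /andP[/andP[p1 pk] _].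
move: pk; rewrite leq_min => /andP[pn pk].
rewrite modCM ler_pM ?modC_ge0 //.
  by rewrite modCM modCV ler_wpM2r ?invr_ge0 ?modC_ge0 // modC_le_alpha // p1.
by rewrite subSn // hY ?p1 // ltn_subrL p1.
Qed.

(** Indexed to match [W(k+1)]; the scaling removes [N] from the quadratic term of the recursion. *)
Definition scaledS (k : nat) : R := Sseq n al r0 k.+1 * N.

Lemma scaledSE (k : nat) : (1 <= k)%N ->
  scaledS k = r0^-1 * (\sum_(1 <= p < k) (scaledS p + al) * scaledS (k - p)%N)
              + al * N + al.
Proof.
have N0 : N != 0 by rewrite gt_eqF ?normM_gt0.
case: k => [//|[|k]] _.
  by rewrite /scaledS S2E big_geq // mulr0 add0r mulrDl divfK.
rewrite {1}/scaledS SE // 2!mulrDl divfK //; congr (_ + _ + _).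
rewrite -mulrA mulr_suml; congr (_ * _); apply: eq_big_nat => p /andP[p1 pk].
by rewrite -mulrA /scaledS subSn ?[N * _]mulrC // ltnW.
Qed.

Lemma scaledS_ge0 (k : nat) : (1 <= k)%N -> 0 <= scaledS k.
Proof.
have Nge0 := ltW normM_gt0; have al0 := alpha_ge0.
elim/ltn_ind: k => k IH k1; rewrite scaledSE // !addr_ge0 ?mulr_ge0 ?invr_ge0 ?modC_ge0 //.
rewrite big_nat_cond sumr_ge0 // => p /andP[/andP[p1 pk] _].
by rewrite mulr_ge0 ?addr_ge0 ?IH ?subn_gt0 // ltn_subrL p1 (leq_trans _ k1).
Qed.

Variable b : R.
Hypothesis b_ge0 : 0 <= b.
Hypothesis scaledS_le : forall k, (1 <= k < n)%N ->
  scaledS k <= r0 * (catalan R k.-1 * b ^+ k).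

Let Z (k : nat) : R := catalan R k.-1 * b ^+ k / N.
(** Below [n] the bound comes from the recursion for S, from [n] on from the Catalan numbers; the
    value 1 at 0 is the common first coefficient. *)
Let X (k : nat) : R :=
  if k == 0%N then 1 else if (k < n)%N then (scaledS k - al) / (N * r0) else Z k.

(* The coefficient bound X p still leaves room for the term alpha / |a_0|, which
   the recursion contributes exactly when p < n. *)
Let X_slack (p : nat) : (1 <= p)%N ->
  N * X p + (if (p < n)%N then al / r0 else 0) <= N * Z p.
Proof.
have N0 := normM_gt0; have r00 := modC_gt0.
move=> p1; rewrite /X gtn_eqF //; case: ifP => pn; last by rewrite addr0.
have -> : N * ((scaledS p - al) / (N * r0)) + al / r0 = scaledS p / r0.
  by field; rewrite !gt_eqF.
have -> : N * Z p = catalan R p.-1 * b ^+ p by rewrite /Z mulrC divfK // gt_eqF.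
by rewrite ler_pdivrMr // mulrC scaledS_le // p1.
Qed.

Let X_le_Z (p : nat) : (1 <= p)%N -> X p <= Z p.
Proof.
move=> p1; rewrite -(ler_pM2l normM_gt0); apply: le_trans (X_slack p1).
by rewrite lerDl; case: ifP => // _; rewrite divr_ge0 ?alpha_ge0 ?modC_ge0.
Qed.

(** The normalisation by [1 / N] makes the Catalan majorant reproduce itself exactly under the
    quadratic part of the recursion. *)
Let Z_convolution (k : nat) : (2 <= k)%N ->
  N * (\sum_(1 <= p < k) Z p * Z (k - p)%N) = Z k.
Proof.
have N0 : N != 0 by rewrite gt_eqF ?normM_gt0.
case: k => [|[|k]] // _; rewrite /Z /= -catalan_convolution big_add1 big_mkord.
rewrite !mulr_suml mulr_sumr; apply: eq_bigr => p _.
have pk : (p <= k)%N by rewrite -ltnS.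
have -> : (k.+2 - p.+1).-1 = (k - p)%N by lia.
have -> : b ^+ k.+2 = b ^+ p.+1 * b ^+ (k.+2 - p.+1) by rewrite -exprD; congr (_ ^+ _); lia.
by field.
Qed.

Let Wcoef_le_X (k i : nat) : (0 < i < n)%N -> modC (Wcoef n a k.+1 i) <= X k.
Proof.
have N0 := normM_gt0; have r00 := modC_gt0; have al0 := alpha_ge0.
elim/ltn_ind: k i => k IH i lti; have [->|k1] := posnP k.
  by rewrite Wcoef1 // -[1]/(1%:R) modC_nat.
have hX p j : (p < k)%N -> (0 < j < n)%N -> modC (Wcoef n a p.+1 j) <= X p.
  by move=> pk; exact: IH.
apply: le_trans (Wcoef_step k1 lti hX) _.
have lt1 : (0 < 1 < n)%N by [].
have [kn|nk] := ltnP k n.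
  have -> : X k = (scaledS k - al) / (N * r0) by rewrite /X gtn_eqF // kn.
  (* For [k < n] the linear sum reaches [p = k], where [X 0 = 1] contributes a bare
     [alpha / |a_0|]. *)
  rewrite (minn_idPr kn) big_nat_recr //= subnn (_ : X 0 = 1) //.
  rewrite ler_pdivlMr ?mulr_gt0 // [X in X - al]scaledSE //.
  have XE p : (1 <= p < k)%N -> N * r0 * X p = scaledS p - al.
    case/andP=> p1 pk; rewrite /X gtn_eqF // (ltn_trans pk kn) mulrC divfK //.
    by rewrite mulf_neq0 ?gt_eqF.
  (* As [N * r0 * X p + al = scaledS p], the linear term merges into one factor of the convolution.
     The result falls short of [scaledS k - al] by nonnegative cross terms only. *)
  have -> : (N * (\sum_(1 <= p < k) X p * X (k - p)%N)
      + al / r0 * (\sum_(1 <= p < k) X (k - p)%N + 1)) * (N * r0)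
    = r0^-1 * (\sum_(1 <= p < k) scaledS p * (scaledS (k - p)%N - al)) + al * N.
    have -> : \sum_(1 <= p < k) scaledS p * (scaledS (k - p)%N - al)
      = N * r0 * (N * r0 * (\sum_(1 <= p < k) X p * X (k - p)%N)
         + al * \sum_(1 <= p < k) X (k - p)%N).
      rewrite !mulr_sumr -big_split mulr_sumr /=; apply: eq_big_nat => p /andP[p1 pk].
      rewrite -XE ?subn_gt0 ?pk ?ltn_subrL ?p1 //.
      have := XE p; rewrite p1 pk => /(_ isT) /eqP; rewrite eq_sym subr_eq => /eqP ->.
      by ring.
    by field; rewrite gt_eqF.
  rewrite addrK lerD2r ler_wpM2l ?invr_ge0 ?modC_ge0 //.
  rewrite big_nat_cond [leRHS]big_nat_cond; apply: ler_sum => p /andP[/andP[p1 pk] _].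
  have s1 := scaledS_ge0 p1.
  have s2 : 0 <= scaledS (k - p) by rewrite scaledS_ge0 // subn_gt0.
  rewrite -subr_ge0 (_ : _ - _ = scaledS p * al + al * scaledS (k - p)%N); last by ring.
  by rewrite addr_ge0 // mulr_ge0.
have k2 := leq_trans n_ge2 nk.
have nk1 : (n <= k.+1)%N by exact: leqW.
have -> : X k = Z k by rewrite /X gtn_eqF // ltnNge nk.
rewrite -Z_convolution // (minn_idPl nk1).
(* For [k >= n] the linear sum stops at [p = n - 1]. Extended by zeros, it joins the convolution
   termwise, where the slack of [X p] absorbs it. *)
rewrite [X in _ + _ * X](big_nat_widen _ _ k) // [X in _ + _ * X]big_mkcond.
rewrite !mulr_sumr -big_split /=.
rewrite big_nat_cond [leRHS]big_nat_cond; apply: ler_sum => p /andP[/andP[p1 pk] _].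
have Xkp : X (k - p)%N <= Z (k - p)%N by rewrite X_le_Z // subn_gt0.
have Xkp0 : 0 <= X (k - p)%N.
  by apply: le_trans (modC_ge0 _) (hX _ _ _ lt1); rewrite ltn_subrL p1.
have -> : N * (X p * X (k - p)%N) + al / r0 * (if (p < n)%N then X (k - p)%N else 0)
  = (N * X p + (if (p < n)%N then al / r0 else 0)) * X (k - p)%N.
  by case: ifP => _; ring.
rewrite mulrA ler_pM // ?X_slack //.
rewrite addr_ge0 ?mulr_ge0 ?(ltW N0) //.
  exact: le_trans (modC_ge0 _) (hX _ _ pk lt1).
by case: ifP => // _; rewrite divr_ge0 ?modC_ge0.
Qed.

Lemma Wcoef_le (k i : nat) : (1 <= k)%N -> (0 < i < n)%N ->
  modC (Wcoef n a k.+1 i) <= catalan R k.-1 * b ^+ k / N.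
Proof. by move=> k1 lti; apply: le_trans (Wcoef_le_X k lti) (X_le_Z k1). Qed.

End Majorant.

(** * Absolute convergence below [LBRC] *)

Lemma abs_cvg_LBRC (R : realType) (n : nat) (a : nat -> R[i]) (rho theta t : R) :
    (2 <= n)%N -> 0 < rho -> a 0%N = rho%:C * expi theta ->
    (`|t|%:E < LBRC n (alpha n a) (modC (a 0%N)))%E ->
  cvgn (fun q => \sum_(1 <= m < q.+1) modC (beta n a rho theta m * t%:C ^+ m)).
Proof.
move=> n_ge2 rho_gt0 a0E; have a0_neq0 := a0_neq0 rho_gt0 a0E.
have n0 : n%:R != 0 :> R by rewrite pnatr_eq0; lia.
rewrite /LBRC (modC_a0 rho_gt0 a0E); set B := \big[_/_]_(1 <= k < n) _ => tB.
have B0 : 0 <= B by exact: bigmax_ge_id.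
have s1 : 4 * B * `|t| < 1.
  (* If [B = 0] then [LBRC] is infinite and the ratio [4 * B * |t|] is 0. *)
  move: tB; rewrite inver; have [->|Bn0] := eqVneq B 0; first by rewrite mulr0 mul0r.
  rewrite -EFinM lte_fin -invfM => tB.
  have B4 : 0 < 4 * B by rewrite mulr_gt0 // lt0r Bn0.
  by rewrite mulrC -ltr_pdivlMr // mul1r.
have c0 : 0 < rho `^ n%:R^-1 := powR_gt0 _ rho_gt0.
have N0 : 0 < normM R n := normM_gt0 R n_ge2.
(* Since [rho^(1 - k/n) = rho / rho^(k/n)], this [b] turns the maximality of [B] into the Catalan
   bound on [scaledS]; moreover [b |tau| = B |t|]. *)
pose b := B / rho `^ n%:R^-1.
have b0 : 0 <= b by rewrite divr_ge0 ?powR_ge0.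
have sb k : (1 <= k < n)%N -> scaledS n a k <= modC (a 0%N) * (catalan R k.-1 * b ^+ k).
  move=> ltk; have /andP[k1 kn] := ltk.
  have k0 : k%:R != 0 :> R by rewrite pnatr_eq0 -lt0n.
  have cat0 := catalan_gt0 R k.-1.
  rewrite (modC_a0 rho_gt0 a0E).
  have d0 : 0 < catalan R k.-1 * rho `^ (1 - k%:R / n%:R) by rewrite mulr_gt0 ?powR_gt0.
  have : (scaledS n a k / (catalan R k.-1 * rho `^ (1 - k%:R / n%:R))) `^ k%:R^-1 <= B.
    rewrite /scaledS (modC_a0 rho_gt0 a0E) /B.
    apply: (@le_bigmax_seq _ _ _ _ _ k xpredT (fun k => (Sseq n (alpha n a) rho k.+1 * normM R n /
      (catalan R k.-1 * rho `^ (1 - k%:R / n%:R))) `^ k%:R^-1)) => //.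
    by rewrite mem_index_iota.
  have s0 := scaledS_ge0 a n_ge2 k1.
  move=> /(lerXn2r k); rewrite !nnegrE powR_ge0 => /(_ isT B0).
  rewrite -powR_mulrn ?powR_ge0 // -powRrM mulVf // powRr1 ?divr_ge0 ?(ltW d0) //.
  rewrite ler_pdivrMr // => /le_trans; apply.
  have -> : rho `^ (1 - k%:R / n%:R) = rho / (rho `^ n%:R^-1) ^+ k.
    rewrite powRD; last by rewrite (gt_eqF rho_gt0) implybT.
    rewrite powRr1 ?ltW // powRN; congr (_ / _).
    by rewrite mulrC powRrM powR_mulrn ?powR_ge0.
  rewrite /b expr_div_n le_eqVlt; apply/orP; left; apply/eqP; field.
  by rewrite expf_neq0 // gt_eqF.
have Wle k := Wcoef_le n_ge2 a0_neq0 b0 sb (k := k) (i := 1).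
(* The last factor covers both the first coefficient 1 and the [1 / N] bounding all later ones; the
   rest is the [|tau|] of the degree shift. *)
pose K := rho `^ n%:R^-1 * `|t| * (1 + (normM R n)^-1).
have s01 : 0 <= 4 * B * `|t| < 1 by rewrite s1 andbT !mulr_ge0.
apply: (@bounded_sum_cvg _ _ (K / (1 - 4 * B * `|t|))) => [m|]; first exact: modC_ge0.
apply: geometric_sum_le => // m; rewrite modC_ge0 /=.
rewrite modCM modCX modC_real betaE modCM modCX modC_root_a0.
have lt1 : (0 < 1 < n)%N by [].
have Wm : modC (Wcoef n a m.+1 1) <= (1 + (normM R n)^-1) * (4 * b) ^+ m.
  have Ni0 : 0 <= (normM R n)^-1 by rewrite invr_ge0 ltW.
  case: m => [|m].
    by rewrite Wcoef1 // -[1]/(1%:R) modC_nat expr0 mulr1 lerDl.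
  apply: le_trans (Wle m.+1 isT lt1) _; rewrite /= mulrC ler_pM //.
  - by rewrite mulr_ge0 ?exprn_ge0 ?(ltW (catalan_gt0 _ _)).
  - by rewrite lerDr.
  rewrite [leRHS]exprMn; apply: ler_wpM2r; first exact: exprn_ge0.
  apply: le_trans (catalan_le _ _) _.
  by rewrite ler_weXn2l // ler1n.
have -> : K * (4 * B * `|t|) ^+ m = (rho `^ n%:R^-1) ^+ m.+1 *
    ((1 + (normM R n)^-1) * (4 * b) ^+ m) * `|t| ^+ m.+1.
  have -> : B = b * rho `^ n%:R^-1 by rewrite /b divfK // gt_eqF.
  by rewrite /K !exprMn !exprS; ring.
by rewrite ler_wpM2r ?exprn_ge0 // ler_wpM2l ?exprn_ge0 ?powR_ge0.
Qed.

Theorem theorem5p1 (R : realType) (n : nat) (hn : (2 <= n)%N)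
    (a : nat -> R[i]) (rho theta : R) (hrho : 0 < rho)
    (htheta : - pi < theta <= pi) (ha0 : a 0%N = rho%:C * expi theta) :
  ((forall t : R, (`|t|%:E < RC n a rho theta)%E ->
      cvgn (fun q => \sum_(1 <= m < q.+1)
                       modC (beta n a rho theta m * t%:C ^+ m))) /\
   (forall t : R, (`|t|%:E < LBRC n (alpha n a) (modC (a 0%N)))%E ->
      cvgn (fun q => \sum_(1 <= m < q.+1)
                       modC (beta n a rho theta m * t%:C ^+ m)))) /\
  (forall t : R, (`|t|%:E < RC n a rho theta)%E ->
     forall k : nat, (k < n)%N ->
       cvgn (xpart n a rho theta t k : nat -> R[i]^o) /\
       (fun q => Eres n a t (xpart n a rho theta t k q)) @ \oo --> (0 : R[i]^o)).
Proof.
split; first split=> t.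
- exact: abs_cvg_RC.
- exact: abs_cvg_LBRC.
move=> t tRC k _; split; first exact: xpart_cvg.
exact: Eres_xpart_cvg0.
Qed.
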